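(* For integers $k\geq 1$ and $0\leq s\leq k$, $$GR_k(s\cdot K_4+e, (k-s)\cdot K_3) =\begin{cases} 17^{s/2}\cdot5^{(k-s)/2}+1, & \text{if $s$ is even and $k-s$ is even,} \\ 2\cdot17^{s/2}\cdot5^{(k-s-1)/2}+1, & \text{if $s$ is even and $k-s$ is odd,} \\ 8\cdot17^{(s-1)/2}\cdot5^{(k-s-1)/2}+1, & \text{if $s$ is odd and $k-s$ is odd,} \\ 4\cdot 17^{(s-1)/2}\cdot5^{(k-s)/2}+1, & \text{if $s$ is odd and $k-s$ is even.}\end{cases}$$
   Context: $K_4+e$ denotes the graph on five vertices consisting of a $K_4$ together with a pendant edge. A Gallai-$k$-coloring is an edge-coloring of a complete graph with colors from $[k]$ containing no rainbow triangle (triangle with three distinct colors). For graphs $H_1,\dots,H_k$, $GR(H_1,\dots,H_k)$ is the minimum integer $N$ such that every Gallai-$k$-coloring of $K_N$ contains, for some $i\in[k]$, a copy of $H_i$ all of whose edges have color $i$. $GR_k(s\cdot K_4+e, (k-s)\cdot K_3)$ denotes $GR(H_1,\dots,H_k)$ with $H_1=\dots=H_s=K_4+e$ and $H_{s+1}=\dots=H_k=K_3$. *)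

(* Defs.v *)
From mathcomp Require Import all_boot.
Set Implicit Arguments.
Unset Strict Implicit.
Unset Printing Implicit Defensive.

Record sgraph := SGraph {
  vertex :> finType;
  adj : rel vertex;
  adj_sym : symmetric adj;
  adj_irr : irreflexive adj
}.

Definition K_adj (n : nat) : rel 'I_n := fun u v => u != v.

Lemma K_adj_sym n : symmetric (@K_adj n).
Proof. by move=> u v; rewrite /K_adj eq_sym. Qed.

Lemma K_adj_irr n : irreflexive (@K_adj n).
Proof. by move=> u; rewrite /K_adj eqxx. Qed.

Definition K (n : nat) : sgraph := SGraph (@K_adj_sym n) (@K_adj_irr n).

(* The K_4 lives on the vertices 0, 1, 2, 3; the pendant edge joins 0 and 4. *)
Definition K4e_adj : rel 'I_5 := fun u v =>
  (u != v) &&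
  [|| (u < 4) && (v < 4), (u == 0 :> nat) && (v == 4 :> nat)
    | (u == 4 :> nat) && (v == 0 :> nat)].

Lemma K4e_adj_sym : symmetric K4e_adj.
Proof.
move=> u v; rewrite /K4e_adj eq_sym; congr (_ && _).
by rewrite [(v < 4) && _]andbC [(v == 0 :> nat) && _]andbC
  [(v == 4 :> nat) && _]andbC; congr (_ || _); rewrite orbC.
Qed.

Lemma K4e_adj_irr : irreflexive K4e_adj.
Proof. by move=> u; rewrite /K4e_adj eqxx. Qed.

Definition K4e : sgraph := SGraph K4e_adj_sym K4e_adj_irr.

(* An edge-coloring of K_N with colors in [k] is a symmetric c; its values on
   the diagonal are junk and never used below. *)
Definition edge_coloring (k N : nat) (c : 'I_N -> 'I_N -> 'I_k) : Prop :=
  forall x y, c x y = c y x.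

Definition rainbow_triangle (k N : nat) (c : 'I_N -> 'I_N -> 'I_k)
    (x y z : 'I_N) : Prop :=
  [/\ x != y, y != z & x != z] /\
  [/\ c x y != c y z, c y z != c x z & c x y != c x z].

Definition Gallai_coloring (k N : nat) (c : 'I_N -> 'I_N -> 'I_k) : Prop :=
  edge_coloring c /\ forall x y z, ~ rainbow_triangle c x y z.

(* Copies are not required to be induced. *)
Definition mono_copy (k N : nat) (c : 'I_N -> 'I_N -> 'I_k) (H : sgraph)
    (i : 'I_k) : Prop :=
  exists f : H -> 'I_N,
    injective f /\ forall u v, adj u v -> c (f u) (f v) = i.

Definition Gallai_arrows (k : nat) (H : 'I_k -> sgraph) (N : nat) : Prop :=
  forall c : 'I_N -> 'I_N -> 'I_k,
    Gallai_coloring c -> exists i : 'I_k, mono_copy c (H i) i.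

(* is_GR H N says that GR(H_1, ..., H_k) exists and equals N. *)
Definition is_GR (k : nat) (H : 'I_k -> sgraph) (N : nat) : Prop :=
  Gallai_arrows H N /\ forall M : nat, Gallai_arrows H M -> N <= M.

(* Colors are numbered from 0, so the first s colors are those with i < s. *)
Definition K4e_K3_family (k s : nat) (i : 'I_k) : sgraph :=
  if i < s then K4e else K 3.

(* Main.v *)
(* Write f(s, k - s) for the claimed value minus one: each pair of K_4 + e colours
   contributes a factor 17, each pair of K_3 colours a factor 5, and an unpaired
   colour a factor 4 or 2 respectively.

   Lower bound: start from a monochromatic K_4 (or a point) and repeatedly blow
   it up along the Paley colouring of K_17, the pentagon colouring of K_5, or K_2,
   each time with new colours.

   Upper bound, by induction on the vertex set V, for colourings in which some
   colours may exclude K_4 + e, some K_3, and the others all edges.  If a single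
   colour joins two complementary parts of V, then the bound follows by induction
   from those two.  Otherwise V has a Gallai partition with a reduced graph in two
   colours, red and blue, and every part has neighbours in both.  Hence a red
   K_4 + e-free colouring has no red K_4 at all, and the red clique number drops
   inside each part.  Let S be a largest subset of V coloured with red and blue
   only: it meets every part, and does so at least twice if the part contains a
   red or a blue edge, so that the classical values R(3,3) = 6, R(3,4) = 9 and
   R(4,4) = 18, which bound |S|, bound a weighted number of parts. *)

Require Import Defs.
From mathcomp Require Import all_boot.
From mathcomp Require Import zify.

Set Implicit Arguments.
Unset Strict Implicit.
Unset Printing Implicit Defensive.

(** * Gallai partitions *)

Section GallaiStructure.
Context (T C : finType) (c : T -> T -> C).
Context (c_sym : forall x y, c x y = c y x).
Context (c_tri : forall x y z, x != y -> y != z -> x != z ->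
  c x y != c x z -> c y z = c x y \/ c y z = c x z).

Definition color_rel (V : {set T}) (i : C) : rel T :=
  [rel x y | [&& x \in V, y \in V, x != y & c x y == i]].

Definition color_connected (V : {set T}) (i : C) :=
  [forall x in V, forall y in V, connect (color_rel V i) x y].

Lemma color_connect_sym V i : connect_sym (color_rel V i).
Proof.
by apply: sym_connect_sym => x y; rewrite /color_rel /= (c_sym y) (eq_sym y) andbCA.
Qed.

(** Along an edge [x w] of colour [i], neither [x z] nor [w z] has colour [i], as [z] lies outside
    the component; a triangle that is not rainbow then forces [c x z = c w z]. Iterate along a
    path. *)
Lemma component_homogeneous V i x y z :
  connect (color_rel V i) x y -> x \in V -> z \in V ->
  ~~ connect (color_rel V i) x z -> c x z = c y z.
Proof.
case/connectP=> s; elim: s x => [|w s IHs] x /=; first by move=> _ ->.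
case/andP=> xw ws def_y xV zV nxz.
have nwz : ~~ connect (color_rel V i) w z.
  by apply: contra nxz; apply: connect_trans; apply: connect1.
have /and4P [_ wV neq_xw /eqP cxw] := xw.
rewrite -(IHs w) //.
have neq_xz : x != z by apply: contraNneq nxz => ->.
have neq_wz : w != z by apply: contraNneq nwz => ->.
have cxz : c x z != i.
  by apply: contra nxz => cxz; apply: connect1; apply/and4P.
have cwz : c w z != i.
  by apply: contra nwz => cwz; apply: connect1; apply/and4P.
case: (c_tri neq_xw neq_wz neq_xz) => [|cwzi|->] //.
  by rewrite cxw eq_sym.
by rewrite cwzi cxw eqxx in cwz.
Qed.

(** Follow a path of colour [i] up to its first visit to [v]; [x1] is the vertex just before. *)
Lemma connect_before V i x v :
  connect (color_rel V i) x v -> x \in V -> x != v ->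
  exists x1, [/\ x1 \in V :\ v, connect (color_rel (V :\ v) i) x x1
               & c v x1 = i].
Proof.
case/connectP=> s; elim: s x => [|w s IHs] x /=; first by move=> _ ->; rewrite eqxx.
case/andP=> /and4P [_ wV neq_xw /eqP cxw] ws def_v xV neq_xv.
have [def_w | neq_wv] := eqVneq w v.
  by exists x; rewrite !inE neq_xv xV connect0 c_sym -def_w.
have [x1 [x1V wx1 cx1]] := IHs w ws def_v wV neq_wv.
exists x1; split=> //; apply: connect_trans wx1; apply: connect1.
by apply/and4P; split; rewrite ?inE ?neq_xv ?neq_wv //; apply/eqP.
Qed.

(* If colour i is connected on V but not on V minus v, then v sends an edge of
   colour i into every i-component of V minus v, and this forces all the other
   edges at v to have the same colour. *)
Lemma two_colors_at (V : {set T}) i v x y :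
  v \in V -> color_connected V i -> ~~ color_connected (V :\ v) i ->
  x \in V :\ v -> y \in V :\ v -> c v x != i -> c v y != i -> c v x = c v y.
Proof.
move=> vV conn nconn.
set e := color_rel (V :\ v) i.
have into u : u \in V :\ v -> exists u1, [/\ u1 \in V :\ v, connect e u u1
               & c v u1 = i].
  case/setD1P=> neq_uv uV; apply: connect_before => //.
  by move/forall_inP/(_ _ uV)/forall_inP/(_ _ vV): conn.
have other x1 y1 : x1 \in V :\ v -> y1 \in V :\ v -> ~~ connect e x1 y1 ->
    c v x1 != i -> c v y1 = i -> c x1 y1 = c v x1.
  move=> x1V y1V nxy cx1 cy1.
  have /setD1P [neq_x1v _] := x1V; have /setD1P [neq_y1v _] := y1V.
  have neq_xy : x1 != y1 by apply: contraNneq nxy => ->.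
  case: (@c_tri v x1 y1); rewrite 1?[v == _]eq_sym ?cy1 // => cxy.
  by case/negP: nxy; apply: connect1; apply/and4P; split; rewrite ?cxy.
move=> xV yV cx cy.
have [x1 [x1V xx1 cx1]] := into x xV.
have [y1 [y1V yy1 cy1]] := into y yV.
have eC := color_connect_sym (V :\ v) i.
(* If [x] and [y] lie in different components, homogeneity shows that both colours equal that of
   [x1 y1]. Otherwise an [i]-neighbour [z1] of [v] in another component sees [x] and [y] in the same
   colour. *)
have [cxy | nxy] := boolP (connect e x y); last first.
  have nxy1 : ~~ connect e x y1.
    by apply: contra nxy => xy1; apply: connect_trans xy1 _; rewrite eC.
  have nyx1 : ~~ connect e y x1.
    by apply: contra nxy => yx1; apply: connect_trans xx1 _; rewrite eC.
  rewrite -(other x y1) // -(other y x1) //.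
  rewrite (component_homogeneous xx1 _ _ nxy1) // c_sym.
  by rewrite -(component_homogeneous yy1 _ _ nyx1).
have [z zV nxz] : exists2 z, z \in V :\ v & ~~ connect e x z.
  apply/exists_inP; rewrite -negb_forall_in; apply: contra nconn => allx.
  apply/forall_inP=> u uV; apply/forall_inP=> w wV.
  apply: (@connect_trans _ _ x); last exact: (forall_inP allx).
  by rewrite -/e eC; apply: (forall_inP allx).
have [z1 [z1V zz1 cz1]] := into z zV.
have nxz1 : ~~ connect e x z1.
  by apply: contra nxz => xz1; apply: connect_trans xz1 _; rewrite eC.
have nyz1 : ~~ connect e y z1.
  by apply: contra nxz1 => yz1; apply: connect_trans cxy yz1.
rewrite -(other x z1) // -(other y z1) //.
exact: (component_homogeneous cxy _ _ nxz1).
Qed.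

(** By induction, deleting [v] disconnects one of the three colours, so by [two_colors_at] at most
    two colours occur at [v]; but three connected colours must all occur there. *)
Lemma three_connected_colors (V : {set T}) i1 i2 i3 :
  1 < #|V| -> i1 != i2 -> i2 != i3 -> i1 != i3 ->
  color_connected V i1 -> color_connected V i2 -> color_connected V i3 -> False.
Proof.
move=> V1 n12 n23 n13 h1 h2 h3.
have hs : all (color_connected V) [:: i1; i2; i3] by rewrite /= h1 h2 h3.
elim: {V}_.+1 {-2}V (ltnSn #|V|) V1 hs {h1 h2 h3} => // n IHn V Vn V1 hs.
have [v vV] : exists v, v \in V by apply/card_gt0P; apply: ltnW.
have cardV := cardsD1 v V; rewrite vV /= in cardV.
have [w wV] : exists w, w \in V :\ v by apply/card_gt0P; lia.
have [i [_ i_col]] : exists i, i \in [:: i1; i2; i3] /\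
    {in V :\ v &, forall x y, c v x != i -> c v y != i -> c v x = c v y}.
  have [V'1 | V'1] := leqP #|V :\ v| 1.
    exists i1; split; first by rewrite inE eqxx.
    by move=> x y xV yV _ _; rewrite (card_le1_eqP V'1 x y xV yV).
  have /allPn [i i_in nconn] : ~~ all (color_connected (V :\ v)) [:: i1; i2; i3].
    by apply/negP => /IHn; apply=> //; lia.
  exists i; split=> // x y; apply: two_colors_at => //.
  exact: (allP hs).
have at_v j : j \in [:: i1; i2; i3] -> exists2 x, x \in V :\ v & c v x = j.
  move/(allP hs)=> connj; have /setD1P [neq_wv wV'] := wV.
  move/forall_inP/(_ _ wV')/forall_inP/(_ _ vV): connj => /connect_before.
  by case=> // x [xV _ cx]; exists x.
have [x1 x1V cx1] := at_v i1 (mem_head _ _).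
have [x2 x2V cx2] : exists2 x, x \in V :\ v & c v x = i2.
  by apply: at_v; rewrite !inE eqxx orbT.
have [x3 x3V cx3] : exists2 x, x \in V :\ v & c v x = i3.
  by apply: at_v; rewrite !inE eqxx !orbT.
have e12 := i_col _ _ x1V x2V; have e13 := i_col _ _ x1V x3V.
have e23 := i_col _ _ x2V x3V; rewrite cx1 cx2 cx3 in e12 e13 e23.
have [di1 | ni1] := eqVneq i1 i.
  by move: n23; rewrite e23 ?eqxx // -di1 eq_sym.
have [di2 | ni2] := eqVneq i2 i.
  by move: n13; rewrite e13 ?eqxx // -di2 eq_sym.
by move: n12; rewrite e12 ?eqxx.
Qed.

(* The parts are the fibres of p; the reduced graph is V restricted to the image
   of p, although p x need not lie in the part of x. *)
Theorem gallai_partition (V : {set T}) : 1 < #|V| ->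
  exists p r b,
  [/\ {in V, forall x, p x \in V},
      {in V &, forall x y, p x != p y ->
         c x y = c (p x) (p y) /\ c x y \in [:: r; b]}
    & exists x y, [/\ x \in V, y \in V & p x != p y]].
Proof.
elim: {V}_.+1 {-2}V (ltnSn #|V|) => // n IHn V Vn V1.
pose used i := [exists x in V, exists y in V, (x != y) && (c x y == i)].
have usedP x y : x \in V -> y \in V -> x != y -> used (c x y).
  move=> xV yV nxy; apply/exists_inP; exists x => //; apply/exists_inP.
  by exists y; rewrite ?nxy /=.
(* If a used colour is disconnected, contract its components to their roots. The set [V'] of roots
   is smaller because the colour is used, and keeps at least two elements because it is
   disconnected. *)
have [/existsP [i /andP [nconn ui]] | all_conn] :=
    boolP [exists i, ~~ color_connected V i && used i].
  set e := color_rel V i in nconn; have eC := color_connect_sym V i.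
  have conn_root x : connect e x (root e x) by apply: connect_root.
  have rootV x : x \in V -> root e x \in V.
    move=> xV; case/connectP: (conn_root x) => s; elim/last_ind: s => [_ -> //|s y _].
    by rewrite rcons_path last_rcons => /andP [_ /and4P [_ yV _ _]] ->.
  pose V' := root e @: V.
  have V'V : V' \subset V by apply/subsetP => _ /imsetP [x xV ->]; apply: rootV.
  have V'lt : #|V'| < #|V|.
    rewrite ltn_neqAle leq_imset_card andbT; apply/imset_injP => injr.
    have /exists_inP [x xV /exists_inP [y yV /andP [nxy cxy]]] := ui.
    case/eqP: (nxy); apply: injr => //; apply/eqP; rewrite root_connect //.
    by apply: connect1; apply/and4P.
  have V'1 : 1 < #|V'|.
    move: nconn; rewrite negb_forall_in => /exists_inP [x xV].
    rewrite negb_forall_in => /exists_inP [y yV nxy].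
    apply/card_gt1P; exists (root e x), (root e y).
    by rewrite !imset_f // root_connect.
  have [p [r [b [pV' p_hom [x [y [xV yV nxy]]]]]]] := IHn V' (leq_trans V'lt Vn) V'1.
  exists (p \o root e), r, b; split=> [z zV | z t zV tV nzt | ].
  - by apply: (subsetP V'V); apply: pV'; apply: imset_f.
  - have nrzt : root e z != root e t by apply: contraNneq nzt => /= ->.
    have nzt_conn : ~~ connect e z t by rewrite -root_connect.
    have -> : c z t = c (root e z) (root e t).
      rewrite (component_homogeneous (conn_root z)) // c_sym [RHS]c_sym.
      apply: component_homogeneous (conn_root t) _ _ _; rewrite ?rootV //.
      by rewrite -/e -root_connect // (root_root eC) eq_sym.
    by apply: p_hom nzt; apply: imset_f.
  - have /imsetP [x' x'V def_x] := xV; have /imsetP [y' y'V def_y] := yV.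
    by exists x', y'; rewrite /= -def_x -def_y.
(* Otherwise all used colours are connected, so there are at most two of them, and the partition
   into singletons works. *)
have conn x y : x \in V -> y \in V -> x != y -> color_connected V (c x y).
  move=> xV yV nxy; apply: contraR all_conn => nconn.
  by apply/existsP; exists (c x y); rewrite nconn usedP.
have /card_gt1P [x0 [y0 [x0V y0V n0]]] := V1.
pose r := c x0 y0.
(* The default [r] covers the case of a single used colour. *)
pose b := odflt r [pick i | used i & i != r].
exists id, r, b; split=> // [x y xV yV nxy | ]; last by exists x0, y0.
split=> //; rewrite !inE; apply/norP => -[nr]; rewrite /b.
case: pickP => [i /andP [ui nir] nb | /(_ (c x y))]; last by rewrite usedP ?nr.
have /exists_inP [x1 x1V /exists_inP [y1 y1V /andP [n1 /eqP c1]]] := ui.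
apply: (@three_connected_colors V r i (c x y)) => //; rewrite 1?eq_sym //.
- exact: conn.
- by rewrite -c1; apply: conn.
- exact: conn.
Qed.

Definition decomposable (V : {set T}) :=
  exists (A : {set T}) (i : C),
  [/\ A != set0, A \proper V & {in A & V :\: A, forall x y, c x y = i}].

Lemma decomposableP (V : {set T}) :
  reflect (decomposable V)
    [exists A : {set T}, exists i, [&& A != set0, A \proper V &
       [forall x in A, forall y in V :\: A, c x y == i]]].
Proof.
apply: (iffP existsP) => [[A /existsP [i /and3P [A0 AV h]]] | [A [i [A0 AV h]]]].
  exists A, i; split=> // x y xA yVA.
  by apply/eqP; apply: (forall_inP (forall_inP h x xA)).
exists A; apply/existsP; exists i; rewrite A0 AV /=.
by apply/forall_inP => x xA; apply/forall_inP => y yVA; rewrite h.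
Qed.

Definition reduced_by (V : {set T}) (p : T -> T) (r b : C) :=
  [/\ r != b,
      {in V & V & V, forall x y z, p x = p y -> p x != p z -> c x z = c y z},
      {in V &, forall x z, p x != p z -> c x z \in [:: r; b]} &
      {in V, forall x, (exists2 y, y \in V & p x != p y /\ c x y = r) /\
                       (exists2 y, y \in V & p x != p y /\ c x y = b)}].

Lemma reduced_byC V p r b : reduced_by V p r b -> reduced_by V p b r.
Proof.
case=> nrb hom two both; split; rewrite 1?eq_sym //.
  by move=> x z xV zV nxz; have := two x z xV zV nxz; rewrite !inE orbC.
by move=> x /both [].
Qed.

(** A part without neighbours in one of the two colours would be joined to the rest of [V] in the
    other colour alone, which is a decomposition; [r = b] is excluded in the same way. *)
Lemma gallai_partition_indecomposable (V : {set T}) :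
  1 < #|V| -> ~ decomposable V -> exists p r b, reduced_by V p r b.
Proof.
move=> V1 indec; have [p [r [b [pV p_hom [x0 [y0 [x0V y0V n0]]]]]]] := gallai_partition V1.
have hom : {in V & V & V, forall x y z, p x = p y -> p x != p z -> c x z = c y z}.
  move=> x y z xV yV zV exy nxz.
  by rewrite (proj1 (p_hom x z xV zV nxz)) exy -(proj1 (p_hom y z yV zV _)) -?exy.
have two : {in V &, forall x z, p x != p z -> c x z \in [:: r; b]}.
  by move=> x z xV zV nxz; case: (p_hom x z xV zV nxz).
have both j j' x : {in V &, forall x z, p x != p z -> c x z = j \/ c x z = j'} ->
    x \in V -> exists2 y, y \in V & p x != p y /\ c x y = j.
  move=> hj xV; suff /exists_inP [y yV /andP [nxy /eqP cxy]] :
      [exists y in V, (p x != p y) && (c x y == j)] by exists y.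
  rewrite -[X in is_true X]negbK negb_exists_in; apply/negP => /forall_inP no_j.
  apply: indec; exists [set y in V | p y == p x], j'; split.
  - by apply/set0Pn; exists x; rewrite inE xV eqxx.
  - apply/properP; split; first by apply/subsetP => y; rewrite inE => /andP [].
    have [e0|e0] := eqVneq (p x0) (p x).
      by exists y0; rewrite // inE y0V /= -e0 eq_sym.
    by exists x0; rewrite // inE x0V.
  - move=> y z; rewrite !inE => /andP [yV /eqP eyx] /andP [].
    move=> nz zV; rewrite zV /= -eyx in nz.
    case: (hj y z yV zV); rewrite 1?eq_sym // => cyz.
    have := no_j z zV; rewrite -eyx 1?eq_sym nz /= -(hom y) // ?cyz ?eqxx //.
    by rewrite eq_sym.
have two' j j' : [:: j; j'] =i [:: r; b] ->
    {in V &, forall x z, p x != p z -> c x z = j \/ c x z = j'}.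
  move=> jj x z xV zV nxz; have := two x z xV zV nxz.
  by rewrite -jj !inE => /orP [] /eqP ->; [left | right].
have hasr x : x \in V -> exists2 y, y \in V & p x != p y /\ c x y = r.
  by apply: both; apply: two'.
have hasb x : x \in V -> exists2 y, y \in V & p x != p y /\ c x y = b.
  by apply: both; apply: two' => j; rewrite !inE orbC.
exists p, r, b; split=> //; last by move=> x xV; split; [apply: hasr | apply: hasb].
apply/eqP => erb; apply: indec; exists [set y in V | p y == p x0], r; split.
- by apply/set0Pn; exists x0; rewrite inE x0V eqxx.
- apply/properP; split; first by apply/subsetP => y; rewrite inE => /andP [].
  by exists y0; rewrite // inE y0V eq_sym.
- move=> y z; rewrite !inE => /andP [yV /eqP eyx] /andP [].
  move=> nz zV; rewrite zV /= -eyx in nz.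
  by have := two y z yV zV; rewrite eq_sym nz !inE -erb orbb => /(_ isT)/eqP.
Qed.

End GallaiStructure.

(** * Clique numbers and two-coloured sets *)

Section CliqueNumber.
Context (T C : finType) (c : T -> T -> C).
Context (c_sym : forall x y, c x y = c y x).

Definition clique (i : C) (X : {set T}) :=
  [forall x in X, forall y in X, (x != y) ==> (c x y == i)].

(** Single vertices count as cliques, so [omega i S <= 1] expresses that [S] has no edge of colour
    [i]. *)
Definition omega (i : C) (S : {set T}) :=
  \max_(X : {set T} | (X \subset S) && clique i X) #|X|.

Lemma cliqueP i (X : {set T}) :
  reflect {in X &, forall x y, x != y -> c x y = i} (clique i X).
Proof.
apply: (iffP forall_inP) => [h x y xX yX nxy | h x xX].
  by have /forall_inP /(_ y yX) := h x xX; rewrite nxy => /eqP.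
by apply/forall_inP => y yX; apply/implyP => nxy; apply/eqP/h.
Qed.

Lemma cliqueS i (X Y : {set T}) : X \subset Y -> clique i Y -> clique i X.
Proof.
move=> /subsetP XY /cliqueP h; apply/cliqueP => x y xX yX.
by apply: h; apply: XY.
Qed.

Lemma clique_le_omega i (X S : {set T}) :
  X \subset S -> clique i X -> #|X| <= omega i S.
Proof.
by move=> XS Xi; apply: (@leq_bigmax_cond _ _ (fun X : {set T} => #|X|));
  rewrite XS.
Qed.

Lemma omega_clique i (S : {set T}) n : n <= omega i S ->
  exists X : {set T}, [/\ X \subset S, clique i X & #|X| = n].
Proof.
move=> nS; suff [Y [YS Yi YE]] :
    exists Y : {set T}, [/\ Y \subset S, clique i Y & n <= #|Y|].
  have /card_geqP [s [s_uniq s_size sY]] := YE.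
  have sY' : [set:: s] \subset Y by apply/subsetP => x; rewrite inE; apply: sY.
  exists [set:: s]; split; first exact: subset_trans YS.
    exact: cliqueS Yi.
  by rewrite cardsE (card_uniqP s_uniq).
pose P := [pred X : {set T} | (X \subset S) && clique i X].
have P0 : 0 < #|P|.
  by apply/card_gt0P; exists set0; rewrite inE sub0set; apply/cliqueP => x; rewrite inE.
have [Y /andP [YS Yi] YE] := @eq_bigmax_cond _ P (fun X : {set T} => #|X|) P0.
by exists Y; split; rewrite // -YE.
Qed.

Lemma omegaS i (A B : {set T}) : A \subset B -> omega i A <= omega i B.
Proof.
move=> AB; have [X [XA Xi <-]] := omega_clique (leqnn (omega i A)).
by apply: clique_le_omega => //; apply: subset_trans AB.
Qed.

Lemma omega_join i (A B S : {set T}) :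
  A \subset S -> B \subset S -> [disjoint A & B] ->
  {in A & B, forall x y, c x y = i} -> omega i A + omega i B <= omega i S.
Proof.
move=> AS BS dAB join.
have [X [XA /cliqueP Xi <-]] := omega_clique (leqnn (omega i A)).
have [Y [YB /cliqueP Yi <-]] := omega_clique (leqnn (omega i B)).
have dXY : [disjoint X & Y].
  by apply: disjointWl XA _; apply: disjointWr YB _.
have /eqP cXY : #|X :|: Y| == #|X| + #|Y| by rewrite (leq_card_setU X Y).
rewrite -cXY; apply: clique_le_omega.
  by rewrite subUset (subset_trans XA) ?(subset_trans YB).
apply/cliqueP => x y /setUP [xX|xY] /setUP [yX|yY] nxy.
- exact: Xi.
- by apply: join; [apply: (subsetP XA) | apply: (subsetP YB)].
- by rewrite c_sym; apply: join; [apply: (subsetP XA) | apply: (subsetP YB)].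
- exact: Yi.
Qed.

Lemma omega_gt0 i (A : {set T}) x : x \in A -> 0 < omega i A.
Proof.
move=> xA; rewrite -(cards1 x); apply: clique_le_omega; first by rewrite sub1set.
by apply/cliqueP => y z /set1P -> /set1P ->; rewrite eqxx.
Qed.

Lemma omega_gt1 i (A : {set T}) x y :
  x \in A -> y \in A -> x != y -> c x y = i -> 1 < omega i A.
Proof.
move=> xA yA nxy cxy.
have := @omega_join i [set x] [set y] A; rewrite !sub1set disjoints1 inE.
move/(_ xA yA nxy) => join; apply: leq_trans (join _).
  exact: leq_add (omega_gt0 i (set11 x)) (omega_gt0 i (set11 y)).
by move=> _ _ /set1P -> /set1P ->.
Qed.

Lemma omega_gt1_edge i (A : {set T}) : 1 < omega i A ->
  exists x y, [/\ x \in A, y \in A, x != y & c x y = i].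
Proof.
case/omega_clique=> X [XA /cliqueP Xi X2].
have /card_gt1P [x [y [xX yX nxy]]] : 1 < #|X| by rewrite X2.
by exists x, y; rewrite !(subsetP XA) // Xi.
Qed.

Lemma omega_nbr i (A S : {set T}) x :
  x \in S -> A \subset S -> {in A, forall y, y != x /\ c x y = i} ->
  omega i A < omega i S.
Proof.
move=> xS AS nbr; apply: leq_trans (omega_join _ AS _ _ : omega i [set x] + _ <= _).
- by rewrite -[X in X <= _]add1n leq_add2r; apply: (@omega_gt0 i _ x); rewrite inE.
- by rewrite sub1set.
- by rewrite disjoints1; apply/negP => /nbr []; rewrite eqxx.
- by move=> _ y /set1P -> /nbr [].
Qed.

Definition nbr i (S : {set T}) x := [set y in S | (y != x) && (c x y == i)].

Lemma omega_nbr_lt i (S : {set T}) x : x \in S -> omega i (nbr i S x) < omega i S.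
Proof.
move=> xS; apply: (@omega_nbr _ _ _ x) => //.
  by apply/subsetP => y; rewrite inE => /andP [].
by move=> y; rewrite inE => /and3P [_ ? /eqP].
Qed.

Lemma nbr_sub i (S : {set T}) x : nbr i S x \subset S.
Proof. by apply/subsetP => y; rewrite inE => /andP []. Qed.

Definition bicolored (r b : C) (S : {set T}) :=
  {in S &, forall x y, x != y -> c x y \in [:: r; b]}.

Lemma bicoloredC r b (S : {set T}) : bicolored r b S -> bicolored b r S.
Proof.
by move=> h x y xS yS nxy; have := h x y xS yS nxy; rewrite !inE orbC.
Qed.

Lemma bicoloredS r b (A S : {set T}) :
  A \subset S -> bicolored r b S -> bicolored r b A.
Proof. by move=> /subsetP AS h x y xA yA; apply: h; apply: AS. Qed.

Lemma bicolored_nbr r b i (S : {set T}) x : bicolored r b S -> bicolored r b (nbr i S x).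
Proof. exact/bicoloredS/nbr_sub. Qed.

Lemma card_nbr_bicolored r b (S : {set T}) x : r != b -> bicolored r b S -> x \in S ->
  #|S| = (#|nbr r S x| + #|nbr b S x|).+1.
Proof.
move=> nrb h xS; rewrite (cardsD1 x S) xS add1n; congr _.+1.
rewrite -cardsUI [X in _ + X](_ : _ = 0) ?addn0.
  apply: eq_card => y; rewrite !inE -!andb_orr andbCA.
  have [-> | nyx] := eqVneq y x; rewrite /= ?andbF //.
  have [yS | //] := boolP (y \in S).
  by have := h x y xS yS; rewrite eq_sym nyx !inE => ->.
apply/eqP; rewrite cards_eq0 -subset0; apply/subsetP => y; rewrite !inE.
move=> /and3P [/and3P [_ _ /eqP ->] _] /andP [_ /eqP erb].
by rewrite erb eqxx in nrb.
Qed.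

Lemma bicolored_omega_le1 r b (S : {set T}) : bicolored r b S -> omega r S <= 1 ->
  #|S| <= omega b S.
Proof.
move=> h r1; apply: clique_le_omega => //; apply/cliqueP => x y xS yS nxy.
have := h x y xS yS nxy; rewrite !inE => /orP [] /eqP // cxy.
by have := omega_gt1 xS yS nxy cxy; rewrite ltnNge r1.
Qed.

(** This is R(3,3) <= 6: the red neighbourhood of [x] has no red edge, so it is a blue clique with
    at most 2 vertices, and likewise with the colours exchanged; 1 + 2 + 2 = 5. *)
Lemma ramsey33 r b (S : {set T}) : r != b -> bicolored r b S -> omega r S <= 2 ->
  omega b S <= 2 -> #|S| <= 5.
Proof.
move=> nrb h r2 b2; have [-> | [x xS]] := set_0Vmem S; first by rewrite cards0.
rewrite (card_nbr_bicolored nrb h xS).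
have hr := omega_nbr_lt r xS; have hb := omega_nbr_lt b xS.
have := bicolored_omega_le1 (@bicolored_nbr r b r S x h).
have := bicolored_omega_le1 (bicoloredC (@bicolored_nbr r b b S x h)).
have := omegaS r (nbr_sub b S x); have := omegaS b (nbr_sub r S x).
lia.
Qed.

(** Deleting [x] removes its degree from the sum, and one more for each of its neighbours: twice the
    degree in total. *)
Lemma handshake i (S : {set T}) : ~~ odd (\sum_(x in S) #|nbr i S x|).
Proof.
elim: {S}_.+1 {-2}S (ltnSn #|S|) => // n IHn S Sn.
have [-> | [x xS]] := set_0Vmem S; first by rewrite big_set0.
have /IHn : #|S :\ x| < n by move: Sn; rewrite (cardsD1 x S) xS; lia.
rewrite (big_setD1 x xS) /=.
have nbrE y : y \in S :\ x -> #|nbr i S y| = (y \in nbr i S x) + #|nbr i (S :\ x) y|.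
  move=> /setD1P [nyx yS]; rewrite (cardsD1 x) !inE xS yS nyx /= eq_sym nyx c_sym.
  congr (_ + _); apply: eq_card => z; rewrite !inE.
  by case: (z != x).
rewrite (eq_bigr _ nbrE) big_split /=.
have -> : \sum_(y in S :\ x) (y \in nbr i S x) = #|nbr i S x|.
  rewrite -sum1_card [RHS]big_mkcond [LHS]big_mkcond /=; apply: eq_bigr => y _.
  rewrite !inE; have [-> | nyx] := eqVneq y x; rewrite /= ?andbF //.
  by case: (y \in S); case: (c x y == i).
by rewrite addnA addnn oddD odd_double.
Qed.

(** This is R(3,4) <= 9: blue degrees are at most 3 and red ones at most 5, so a counterexample has
    9 vertices and is 3-regular in blue, with the odd degree sum 27. *)
Lemma ramsey34 r b (S : {set T}) : r != b -> bicolored r b S -> omega r S <= 3 ->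
  omega b S <= 2 -> #|S| <= 8.
Proof.
move=> nrb h r3 b2; rewrite leqNgt; apply/negP => S9.
have b3 x : x \in S -> #|nbr b S x| = 3 /\ #|S| = 9.
  move=> xS; have := card_nbr_bicolored nrb h xS.
  have hr := omega_nbr_lt r xS; have hb := omega_nbr_lt b xS.
  have := ramsey33 nrb (@bicolored_nbr r b r S x h).
  have := bicolored_omega_le1 (bicoloredC (@bicolored_nbr r b b S x h)).
  have := omegaS r (nbr_sub b S x); have := omegaS b (nbr_sub r S x).
  lia.
have [x xS] : exists x, x \in S by apply/card_gt0P; lia.
have := handshake b S; rewrite (eq_bigr (fun=> 3)) => [|y /b3 [] //].
by rewrite sum_nat_const (proj2 (b3 x xS)).
Qed.

(** This is R(4,4) <= 18, since both neighbourhoods of a vertex have at most 8 elements by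
    [ramsey34]. *)
Lemma ramsey44 r b (S : {set T}) : r != b -> bicolored r b S -> omega r S <= 3 ->
  omega b S <= 3 -> #|S| <= 17.
Proof.
move=> nrb h r3 b3; have [-> | [x xS]] := set_0Vmem S; first by rewrite cards0.
have := card_nbr_bicolored nrb h xS.
have hr := omega_nbr_lt r xS; have hb := omega_nbr_lt b xS.
have nbr : b != r by rewrite eq_sym.
have := ramsey34 nrb (@bicolored_nbr r b b S x h).
have := ramsey34 nbr (bicoloredC (@bicolored_nbr r b r S x h)).
have := omegaS r (nbr_sub b S x); have := omegaS b (nbr_sub r S x).
lia.
Qed.

End CliqueNumber.

(** * Upper bound *)

Fixpoint K4e_factor (a : nat) : nat :=
  if a is a'.+1 then if a' is a''.+1 then 17 * K4e_factor a'' else 4 else 1.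

Fixpoint K3_factor (b : nat) : nat :=
  if b is b'.+1 then if b' is b''.+1 then 5 * K3_factor b'' else 2 else 1.

Definition extremal (a b : nat) : nat := K4e_factor a * K3_factor b.

Lemma nat_ind2 (P : nat -> Prop) :
  P 0 -> P 1 -> (forall n, P n -> P n.+2) -> forall n, P n.
Proof.
move=> P0 P1 PS n; suff [] : P n /\ P n.+1 by [].
by elim: n => // n [Pn PSn]; split=> //; apply: PS.
Qed.

(** The ratios of consecutive values alternate between 4 and 17/4; those of [K3_factor] alternate
    between 2 and 5/2. *)
Lemma K4e_factorS a :
  4 * K4e_factor a <= K4e_factor a.+1 /\ 4 * K4e_factor a.+1 <= 17 * K4e_factor a.
Proof. by elim/nat_ind2: a => // a /=; lia. Qed.

Lemma K3_factorS b :
  2 * K3_factor b <= K3_factor b.+1 /\ 2 * K3_factor b.+1 <= 5 * K3_factor b.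
Proof. by elim/nat_ind2: b => // b /=; lia. Qed.

Lemma K4e_factorE a : K4e_factor a = 17 ^ (a %/ 2) * (if odd a then 4 else 1).
Proof.
rewrite divn2; elim/nat_ind2: a => // a IHa.
by rewrite [RHS]/= negbK expnS -mulnA -IHa.
Qed.

Lemma K3_factorE b : K3_factor b = 5 ^ (b %/ 2) * (if odd b then 2 else 1).
Proof.
rewrite divn2; elim/nat_ind2: b => // b IHb.
by rewrite [RHS]/= negbK expnS -mulnA -IHb.
Qed.

Lemma extremal_gt0 a b : 0 < extremal a b.
Proof.
by rewrite muln_gt0 K4e_factorE K3_factorE !muln_gt0 !expn_gt0; do 2!case: odd.
Qed.

Lemma extremalSS_l a b : extremal a.+2 b = 17 * extremal a b.
Proof. by rewrite /extremal /= mulnA. Qed.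

Lemma extremalSS_r a b : extremal a b.+2 = 5 * extremal a b.
Proof. by rewrite /extremal /= mulnCA. Qed.

Lemma extremalS_l a b : 4 * extremal a b <= extremal a.+1 b /\
  4 * extremal a.+1 b <= 17 * extremal a b.
Proof.
by rewrite /extremal !mulnA !leq_mul2r !(proj1 (K4e_factorS a)) !(proj2 (K4e_factorS a)) !orbT.
Qed.

Lemma extremalS_r a b : 2 * extremal a b <= extremal a b.+1 /\
  2 * extremal a b.+1 <= 5 * extremal a b.
Proof.
rewrite /extremal !(mulnCA _ (K4e_factor a)) !leq_mul2l.
by rewrite !(proj1 (K3_factorS b)) !(proj2 (K3_factorS b)) !orbT.
Qed.

(** * Admissible colourings and the decomposable case *)

Section Admissible.
Context (T C : finType) (c : T -> T -> C).
Context (c_sym : forall x y, c x y = c y x).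

Let omega := omega c.

(* A monochromatic K_4 + e is absent iff no monochromatic K_4 sends out a
   further edge of its colour. *)
Definition K4e_free (i : C) (V : {set T}) :=
  forall X : {set T}, X \subset V -> clique c i X -> #|X| = 4 ->
  {in X & V :\: X, forall x y, c x y <> i}.

(** [X] holds the colours that exclude K_4 + e, [Y] those that exclude K_3; all others are absent
    from [V]. This form is inherited by parts in which a colour has become more restricted. *)
Definition admissible (X Y : {set C}) (V : {set T}) :=
  [/\ [disjoint X & Y],
      (forall i, i \notin X -> i \notin Y -> omega i V <= 1),
      {in Y, forall i, omega i V <= 2} & {in X, forall i, K4e_free i V}].

Lemma K4e_freeS i (A V : {set T}) : A \subset V -> K4e_free i V -> K4e_free i A.
Proof.
move=> AV h X XA Xi X4 x y xX /setDP [yA nyX].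
by apply: (h X) => //; [apply: subset_trans AV | rewrite inE nyX (subsetP AV)].
Qed.

Lemma admissibleS X Y (A V : {set T}) :
  A \subset V -> admissible X Y V -> admissible X Y A.
Proof.
move=> AV [dXY h0 h1 h2]; have le i := omegaS c i AV; split=> // i.
- by move=> iX iY; apply: leq_trans (le i) _; apply: h0.
- by move=> iY; apply: leq_trans (le i) _; apply: h1.
- by move=> iX; apply: K4e_freeS AV _; apply: h2.
Qed.

(** A colour whose clique number has dropped moves to a stricter class, which lowers the bound
    [extremal]. *)
Lemma admissible_K4e_K3 X Y (V : {set T}) i : admissible X Y V -> i \in X -> omega i V <= 2 ->
  admissible (X :\ i) (i |: Y) V.
Proof.
move=> [dXY h0 h1 h2] iX i2; split.
- rewrite disjoint_subset; apply/subsetP => j /setD1P [nji jX].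
  by rewrite !inE negb_or nji (disjointFr dXY).
- move=> j; rewrite !inE; have [-> | nji] := eqVneq j i; first by [].
  by move=> jX jY; apply: h0.
- by move=> j; rewrite !inE => /orP [/eqP -> // | /h1].
- by move=> j /setD1P [_ /h2].
Qed.

Lemma admissible_K4e_none X Y (V : {set T}) i : admissible X Y V -> i \in X -> omega i V <= 1 ->
  admissible (X :\ i) Y V.
Proof.
move=> [dXY h0 h1 h2] iX i1; split.
- by rewrite (disjointWl _ dXY) ?subsetDl.
- move=> j; rewrite !inE; have [-> | nji] := eqVneq j i; first by [].
  by move=> jX jY; apply: h0.
- exact: h1.
- by move=> j /setD1P [_ /h2].
Qed.

Lemma admissible_K3_none X Y (V : {set T}) i : admissible X Y V -> i \in Y -> omega i V <= 1 ->
  admissible X (Y :\ i) V.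
Proof.
move=> [dXY h0 h1 h2] iX i1; split.
- by rewrite (disjointWr _ dXY) ?subsetDl.
- move=> j jX; rewrite !inE; have [-> | nji] := eqVneq j i; first by [].
  by move=> jY; apply: h0.
- by move=> j /setD1P [_ /h1].
- exact: h2.
Qed.

Lemma admissible_disj X Y (V : {set T}) i : admissible X Y V -> i \in X -> i \notin Y.
Proof. by case=> dXY _ _ _ iX; rewrite (disjointFr dXY). Qed.

Definition bounded_below (n : nat) := forall X Y (V : {set T}),
  #|V| < n -> admissible X Y V -> #|V| <= extremal #|X| #|Y|.

(** The clique numbers of the two sides in the joining colour [i] add up to at most that of [V]. For
    [i] in [Y], both sides lose [i], and the factor 2 suffices. *)
Lemma decomposable_bound X Y (V : {set T}) :
  bounded_below #|V| -> admissible X Y V -> decomposable c V ->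
  #|V| <= extremal #|X| #|Y|.
Proof.
move=> IH adm [A [i [/set0Pn [x0 x0A] /properP [AV [y0 y0V ny0A]] join]]].
have y0B : y0 \in V :\: A by rewrite inE ny0A.
have BV : V :\: A \subset V by apply: subsetDl.
have cardV : #|A| + #|V :\: A| = #|V| by rewrite -(cardsID A V) (setIidPr AV).
have A0 : 0 < #|A| by apply/card_gt0P; exists x0.
have B0 : 0 < #|V :\: A| by apply/card_gt0P; exists y0.
have dAB : [disjoint A & V :\: A] by rewrite disjoint_sym disjoints_subset setDE subsetIr.
have := omega_join c_sym AV BV dAB join; rewrite -/omega.
have oA : 0 < omega i A := omega_gt0 c i x0A.
have oB : 0 < omega i (V :\: A) := omega_gt0 c i y0B.
have ABV y : y \in V -> y \in A \/ y \in V :\: A.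
  by move=> yV; rewrite inE yV andbT; case: (y \in A); [left | right].
move: (V :\: A) => B in y0B BV cardV B0 dAB join oB ABV * => oAB.
have admA := admissibleS AV adm; have admB := admissibleS BV adm.
have [_ no_i iK3 iK4] := adm.
have [iX | niX] := boolP (i \in X); last first.
  have [iY | niY] := boolP (i \in Y); last by have := no_i i niX niY; lia.
  have := iK3 i iY => i2.
  have hA : admissible X (Y :\ i) A by apply: admissible_K3_none => //; lia.
  have hB : admissible X (Y :\ i) B by apply: admissible_K3_none => //; lia.
  have := IH _ _ _ _ hA; have := IH _ _ _ _ hB.
  rewrite (cardsD1 i Y) iY add1n.
  have := extremalS_r #|X| #|Y :\ i|; lia.
have cY : #|i |: Y| = #|Y|.+1 by rewrite cardsU1 (admissible_disj adm iX).
have cX : #|X| = #|X :\ i|.+1 by rewrite (cardsD1 i X) iX.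
have f0 := extremal_gt0 #|X :\ i| #|Y|.
have f1 := extremalS_l #|X :\ i| #|Y|; have f2 := extremalS_r #|X :\ i| #|Y|.
(* A K_4 of colour [i] contains all [i]-neighbours of its vertices. As the complete join of [A] and
   [B] is connected in colour [i], this K_4 is all of [V]. *)
have [o3 | o4] := leqP (omega i V) 3; last first.
  have [Q [QV Qi Q4]] := omega_clique o4.
  have closed x y : x \in Q -> y \in V -> c x y = i -> y \in Q.
    move=> xQ yV; apply: contraPT => nyQ.
    by apply: (iK4 i iX Q QV Qi Q4 x y); rewrite // inE nyQ.
  suff VQ : V \subset Q.
    apply: leq_trans (subset_leq_card VQ) _; rewrite Q4 cX.
    by apply: leq_trans (proj1 f1); rewrite leq_pmulr.
  have [q qQ] : exists q, q \in Q by apply/card_gt0P; rewrite Q4.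
  have fromA x y : x \in A -> x \in Q -> y \in B -> y \in Q.
    by move=> xA xQ yB; apply: closed xQ (subsetP BV _ yB) (join _ _ xA yB).
  have fromB x y : x \in B -> x \in Q -> y \in A -> y \in Q.
    by move=> xB xQ yA; apply: closed xQ (subsetP AV _ yA) _; rewrite c_sym join.
  apply/subsetP => y /ABV yAB; have [qA | qB] := ABV q (subsetP QV q qQ).
    by case: yAB => [yA|yB]; [apply: (fromB y0) => //|]; apply: (fromA q).
  by case: yAB => [yA|yB]; [|apply: (fromA x0) => //]; apply: (fromB q).
(* One side loses [i], and on the other [i] becomes a K_3 colour; the sum is at most 1 + 5/2 <= 4
   times the bound without [i]. *)
have [oA1 | oA2] := leqP (omega i A) 1.
  have hA : admissible (X :\ i) Y A by apply: admissible_K4e_none.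
  have hB : admissible (X :\ i) (i |: Y) B by apply: admissible_K4e_K3 => //; lia.
  have := IH _ _ _ _ hA; have := IH _ _ _ _ hB; rewrite cX cY; lia.
have hB : admissible (X :\ i) Y B by apply: admissible_K4e_none => //; lia.
have hA : admissible (X :\ i) (i |: Y) A by apply: admissible_K4e_K3 => //; lia.
have := IH _ _ _ _ hA; have := IH _ _ _ _ hB; rewrite cX cY; lia.
Qed.

End Admissible.

(** * Colourings with a two-coloured reduced graph *)

Section ReducedColoring.
Context (T C : finType) (c : T -> T -> C).
Context (c_sym : forall x y, c x y = c y x).

Let omega := omega c.
Let bicolored := bicolored c.
Let K4e_free := K4e_free c.
Let reduced_by := reduced_by c.

Definition part (p : T -> T) (V : {set T}) x := [set y in V | p y == p x].

Definition part_nbr (p : T -> T) (V : {set T}) i x :=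
  [set y in V | (p x != p y) && (c x y == i)].

Lemma part_sub p (V : {set T}) x : part p V x \subset V.
Proof. by apply/subsetP => y; rewrite inE => /andP []. Qed.

Lemma part_nbr_sub p (V : {set T}) i x : part_nbr p V i x \subset V.
Proof. by apply/subsetP => y; rewrite inE => /andP []. Qed.

Lemma mem_part p (V : {set T}) x : x \in V -> x \in part p V x.
Proof. by rewrite inE eqxx andbT. Qed.

(** Summation over the fibres of [p]; it turns a Ramsey bound on [S] into a bound on [V]. *)
Lemma card_weighted_parts p (S V : {set T}) m n : S \subset V ->
  {in V, forall x, m * #|part p V x| <= n * #|S :&: part p V x|} ->
  m * #|V| <= n * #|S|.
Proof.
move=> SV le_part.
have split_card (A : {set T}) : A \subset V ->
    #|A| = \sum_(l in p @: V) #|A :&: [set y in V | p y == l]|.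
  move=> AV; rewrite -sum1_card (partition_big p [in p @: V]) /=; last first.
    by move=> x xA; apply/imset_f/(subsetP AV).
  apply: eq_bigr => l _; rewrite sum1dep_card; apply: eq_card => x; rewrite !inE.
  by case: (boolP (x \in A)) => // /(subsetP AV) ->.
rewrite (split_card V) // (split_card S SV) !big_distrr /=.
apply: leq_sum => _ /imsetP [x xV ->].
have := le_part x xV; rewrite -/(part p V x).
by rewrite (setIidPr (part_sub p V x)).
Qed.

Section Reduced.
Context (V : {set T}) (p : T -> T) (r b : C) (red : reduced_by V p r b).

Lemma part_proper x : x \in V -> #|part p V x| < #|V|.
Proof.
move=> xV; have [_ _ _ both] := red; have [[y yV [nxy _]] _] := both x xV.
apply: proper_card; apply/properP; split; first exact: part_sub.
by exists y; rewrite // inE yV eq_sym.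
Qed.

Lemma part_nbr_proper i x : x \in V -> #|part_nbr p V i x| < #|V|.
Proof.
move=> xV; apply: proper_card; apply/properP; split; first exact: part_nbr_sub.
by exists x; rewrite // inE eqxx andbF.
Qed.

Lemma omega_part_nbr i x : x \in V ->
  omega i (part p V x) + omega i (part_nbr p V i x) <= omega i V.
Proof.
move=> xV; have [_ hom _ _] := red.
apply: omega_join => //; rewrite ?part_sub ?part_nbr_sub //.
  rewrite disjoint_subset; apply/subsetP => y; rewrite !inE => /andP [_ /eqP ->].
  by rewrite eqxx andbF.
move=> y z; rewrite !inE => /andP [yV /eqP eyx] /and3P [zV nxz /eqP <-].
by apply: hom; rewrite ?eyx.
Qed.

(** Any red neighbour of the part extends a largest red clique in it. The blue version follows
    through [reduced_byC]. *)
Lemma omega_part_lt x : x \in V -> omega r (part p V x) < omega r V.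
Proof.
move=> xV; have [_ _ _ both] := red; have [[y yV [nxy cxy]] _] := both x xV.
have := omega_part_nbr r xV.
have : 0 < omega r (part_nbr p V r x).
  by apply: (@omega_gt0 _ _ _ _ _ y); rewrite inE yV nxy cxy eqxx.
lia.
Qed.

Lemma omega_gt1_reduced : 1 < #|V| -> 1 < omega r V.
Proof.
case/card_gt1P=> x [_ [xV _ _]].
by have := omega_part_lt xV; have := omega_gt0 c r (mem_part p xV); rewrite -/omega; lia.
Qed.

(* A part meeting a red K_4 inside V must lie in it, since it has a red
   neighbour part; so a red K_4 would be joined in blue to the rest of V. *)
Lemma omega_K4e_free_reduced :
  ~ decomposable c V -> K4e_free r V -> omega r V <= 3.
Proof.
move=> indec free; have [nrb hom two both] := red.
rewrite leqNgt; apply/negP => /omega_clique [Q [QV Qr Q4]].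
have closed x y : x \in Q -> y \in V -> c x y = r -> y \in Q.
  move=> xQ yV; apply: contraPT => nyQ.
  by apply: (free Q QV Qr Q4 x y); rewrite // inE nyQ.
have class x z : x \in Q -> z \in V -> p z = p x -> z \in Q.
  move=> xQ zV ezx; have xV := subsetP QV x xQ.
  have [[y yV [nxy cxy]] _] := both x xV.
  have yQ := closed x y xQ yV cxy.
  by apply: (closed y z) => //; rewrite c_sym -(hom x z y) ?ezx.
have [q qQ] : exists q, q \in Q by apply/card_gt0P; rewrite Q4.
have qV := subsetP QV q qQ.
apply: indec; exists Q, b; split.
- by apply/set0Pn; exists q.
- apply/properP; split=> //; have [_ [y yV [nqy cqy]]] := both q qV.
  exists y => //; apply/negP => yQ; move: nrb; rewrite -cqy.
  have /cliqueP Qr' := Qr; rewrite Qr' ?eqxx //.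
  by apply: contraNneq nqy => ->.
- move=> x y xQ /setDP [yV nyQ].
  have nxy : p x != p y by apply: contraNneq nyQ => exy; apply: (class x).
  have := two x y (subsetP QV x xQ) yV nxy; rewrite !inE => /orP [] /eqP // cxy.
  by rewrite (closed x y) in nyQ.
Qed.

(** Take [S] of largest size. Edges between parts are red or blue, so the trace of [S] on a part can
    be exchanged for any bicoloured subset [D] of that part, such as a vertex or a red or blue edge;
    by maximality the trace is at least as large as [D]. *)
Lemma max_bicolored : exists S : {set T},
  [/\ S \subset V, bicolored r b S &
      {in V, forall x, 0 < #|S :&: part p V x| /\
        ((1 < omega r (part p V x)) || (1 < omega b (part p V x)) ->
         1 < #|S :&: part p V x|)}].
Proof.
have [nrb hom two both] := red.
pose P (S : {set T}) := (S \subset V) &&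
  [forall x in S, forall y in S, (x != y) ==> (c x y \in [:: r; b])].
have P_bi (S : {set T}) : reflect (S \subset V /\ bicolored r b S) (P S).
  apply: (iffP andP) => -[SV Sb]; split=> //.
    move=> x y xS yS nxy; apply: implyP nxy.
    exact: (forall_inP (forall_inP Sb x xS)).
  apply/forall_inP => x xS; apply/forall_inP => y yS; apply/implyP; exact: (Sb x y xS yS).
have P0 : P set0 by apply/P_bi; split; rewrite ?sub0set // => x y; rewrite inE.
case: (@arg_maxnP _ set0 P (fun S : {set T} => #|S|) P0) => S /P_bi [SV Sb] Smax.
exists S; split=> // x xV.
have swap (D : {set T}) : D \subset part p V x -> bicolored r b D ->
    #|D| <= #|S :&: part p V x|.
  move=> DA Db; have : P ((S :\: part p V x) :|: D).
    have DV := subset_trans DA (part_sub p V x).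
    have cross y z : y \in S :\: part p V x -> z \in D -> c y z \in [:: r; b].
      rewrite !inE negb_and => /andP [nyA yS] /(subsetP DA).
      rewrite inE => /andP [zV /eqP ezx].
      have yV := subsetP SV y yS; rewrite yV -ezx /= in nyA.
      by have := two y z yV zV nyA; rewrite !inE.
    apply/P_bi; split; first by rewrite subUset DV (subset_trans _ SV) ?subsetDl.
    move=> y z /setUP [yS|yD] /setUP [zS|zD] nyz.
    - by apply: Sb => //; [case/setDP: yS | case/setDP: zS].
    - exact: cross.
    - by rewrite c_sym cross.
    - exact: Db.
  move/Smax; rewrite cardsU (_ : _ :&: D = set0); last first.
    apply/eqP; rewrite -subset0; apply/subsetP => y; rewrite !inE.
    by case/andP=> /andP [nyA _] /(subsetP DA); rewrite inE (negPf nyA).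
  by rewrite cards0 subn0 -(cardsID (part p V x) S); lia.
split.
  rewrite -(cards1 x); apply: swap; first by rewrite sub1set mem_part.
  by move=> y z /set1P -> /set1P ->; rewrite eqxx.
move=> edge; have [y [z [yA zA nyz cyz]]] : exists y z,
    [/\ y \in part p V x, z \in part p V x, y != z & c y z \in [:: r; b]].
  case/orP: edge => /omega_gt1_edge [y [z [yA zA nyz cyz]]];
    by exists y, z; split; rewrite // cyz !inE eqxx ?orbT.
have <- : #|[set y; z]| = 2 by rewrite cards2 nyz.
apply: swap; first by apply/subsetP => t /set2P [] ->.
move=> t u /set2P [] -> /set2P [] ->; rewrite ?eqxx // => _.
by rewrite c_sym.
Qed.

(** The edge [x1 x2] in the part is red. A further vertex of [S] is a blue neighbour of [x1], of
    which there are at most 8 by [ramsey34], or is red to both ends. The latter set [Q] has no red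
    edge, as this would complete a red K_4, so it is a blue clique of size at most 3; 2 + 8 + 3 =
    13. *)
Lemma card_bicolored_edge_in_part (S : {set T}) x : omega r V <= 3 -> omega b V <= 3 ->
  S \subset V -> bicolored r b S -> x \in V -> omega b (part p V x) <= 1 ->
  1 < #|S :&: part p V x| -> #|S| <= 13.
Proof.
move=> r3 b3 SV Sb xV b1 /card_gt1P [x1 [x2 [/setIP [x1S x1A] /setIP [x2S x2A] n12]]].
have [nrb hom _ _] := red.
have no_b y z : y \in part p V x -> z \in part p V x -> y != z -> c y z != b.
  move=> yA zA nyz; apply: contraTneq b1 => cyz; rewrite -ltnNge.
  exact: omega_gt1 cyz.
have c12 : c x1 x2 = r.
  by have := Sb x1 x2 x1S x2S n12; rewrite !inE (negPf (no_b _ _ _ _ _)) // orbF => /eqP.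
pose Q := [set y in S | [&& y != x1, y != x2, c x1 y == r & c x2 y == r]].
have QS : Q \subset S by apply/subsetP => y; rewrite inE => /andP [].
have QV := subset_trans QS SV.
have cover : S \subset [set x1; x2] :|: (nbr c b S x1 :|: Q).
  apply/subsetP => y yS; rewrite !inE yS.
  have [-> // | ny1] := eqVneq y x1; have [-> // | ny2 /=] := eqVneq y x2.
  have := Sb x1 y x1S yS; rewrite eq_sym ny1 !inE => /(_ isT).
  case/orP=> /eqP c1; rewrite c1 eqxx ?orbT //= (negPf nrb) /=.
  have := Sb x2 y x2S yS; rewrite eq_sym ny2 !inE => /(_ isT).
  case/orP=> // /eqP c2; move: x1A x2A; rewrite !inE => /andP [x1V /eqP e1].
  case/andP=> x2V /eqP e2; have yV := subsetP SV y yS.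
  have [exy | nxy] := eqVneq (p y) (p x).
    have yA : y \in part p V x by rewrite inE yV exy eqxx.
    have := no_b x2 y _ yA; rewrite inE x2V e2 c2 !eqxx (eq_sym x2) ny2.
    by move/(_ isT isT).
  move: nrb; rewrite -c1 -c2 (hom x1 x2 y) ?eqxx // ?e1 ?e2 // eq_sym //.
have Q1 : omega r Q <= 1.
  have := @omega_join _ _ c c_sym r [set x1; x2] Q V.
  have := @omega_gt1 _ _ c c_sym r [set x1; x2] x1 x2.
  rewrite !inE !eqxx orbT => /(_ isT isT n12 c12) e2.
  move/(_ _ QV) => join; have := join _ _ _; rewrite -/omega => {}join.
  rewrite -(leq_add2l 2); apply: leq_trans r3; apply: leq_trans (join _ _ _); first by rewrite leq_add2r.
  - by rewrite subUset !sub1set !(subsetP SV).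
  - rewrite disjoint_subset; apply/subsetP => y /set2P [] ->; rewrite !inE eqxx ?andbF //.
  - by move=> y z /set2P [] ->; rewrite inE => /and5P [_ _ _ /eqP ? /eqP].
have Q3 : #|Q| <= 3.
  apply: leq_trans b3; apply: leq_trans (omegaS c b QV).
  exact: (bicolored_omega_le1 c_sym (bicoloredS QS Sb) Q1).
have B8 : #|nbr c b S x1| <= 8.
  apply: (@ramsey34 _ _ c c_sym r b) => //; first exact: bicolored_nbr.
    by apply: leq_trans r3; apply: omegaS; apply: subset_trans SV; apply: nbr_sub.
  rewrite -ltnS; apply: leq_trans (omega_nbr_lt c_sym b x1S) _.
  by apply: leq_trans b3; apply: omegaS.
have := subset_leq_card cover.
have [cU _] := leq_card_setU [set x1; x2] (nbr c b S x1 :|: Q).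
have [cU' _] := leq_card_setU (nbr c b S x1) Q.
by move: cU cU' Q3 B8; rewrite cards2 n12; clear; lia.
Qed.

End Reduced.
End ReducedColoring.

Lemma weight_le m n a k s : m * a <= n * k -> k <= s -> m * a <= n * s.
Proof. by move=> mank ks; apply: leq_trans mank _; rewrite leq_mul2l ks orbT. Qed.

(** * The indecomposable cases and the induction *)

Section UpperBound.
Context (T C : finType) (c : T -> T -> C).
Context (c_sym : forall x y, c x y = c y x).
Context (c_tri : forall x y z, x != y -> y != z -> x != z ->
  c x y != c x z -> c y z = c x y \/ c y z = c x z).

Section Indecomposable.
Context (X Y : {set C}) (V : {set T}) (p : T -> T).
Context (IH : bounded_below c #|V|) (adm : admissible c X Y V).

Lemma part_admissible x : admissible c X Y (part p V x).
Proof. exact: admissibleS (part_sub p V x) adm. Qed.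

(** Both colours vanish inside every part, each part contains a vertex of [S], and [S] has at most 5
    vertices. *)
Lemma reduced_K3_K3 r b : reduced_by c V p r b -> r \in Y -> b \in Y ->
  #|V| <= extremal #|X| #|Y|.
Proof.
move=> red rY bY; have [nrb _ _ _] := red; have redC := reduced_byC red.
have [_ _ /(_ r rY) r2 _] := adm; have [_ _ /(_ b bY) b2 _] := adm.
have [S [SV Sb S_part]] := max_bicolored c_sym red.
have S5 : #|S| <= 5.
  apply: (ramsey33 c_sym nrb Sb).
    exact: leq_trans (omegaS c r SV) r2.
  exact: leq_trans (omegaS c b SV) b2.
have bY' : b \in Y :\ r by rewrite !inE eq_sym nrb.
have -> : #|Y| = #|Y :\ r :\ b|.+2 by rewrite (cardsD1 r) rY (cardsD1 b) bY'.
rewrite extremalSS_r; set u := extremal _ _.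
suff /weight_le/(_ S5) : 1 * #|V| <= u * #|S| by rewrite mul1n mulnC.
apply: (card_weighted_parts (p := p)) => // x xV.
have [S1 _] := S_part x xV.
have lr := omega_part_lt c_sym red xV; have lb := omega_part_lt c_sym redC xV.
have : admissible c X (Y :\ r :\ b) (part p V x).
  apply: admissible_K3_none bY' _; last by lia.
  by apply: admissible_K3_none (part_admissible x) rY _; lia.
by move/(IH (part_proper red xV)) => Au; apply: (weight_le _ S1); rewrite mul1n muln1.
Qed.

(** Blue vanishes inside every part. A part without red edges has at most [u <= w / 2] vertices and
    one in [S]; a part with red edges has at most [w] and two in [S]. Hence there are at most
    [w / 2] vertices per element of [S], and 8 elements give [4 * w]. *)
Lemma reduced_K4e_K3 r b : reduced_by c V p r b -> ~ decomposable c V ->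
  r \in X -> b \in Y -> #|V| <= extremal #|X| #|Y|.
Proof.
move=> red indec rX bY; have [nrb _ _ _] := red; have redC := reduced_byC red.
have [_ _ /(_ b bY) b2 /(_ r rX) rK4] := adm.
have r3 := omega_K4e_free_reduced c_sym red indec rK4.
have [S [SV Sb S_part]] := max_bicolored c_sym red.
have S8 : #|S| <= 8.
  apply: (ramsey34 c_sym nrb Sb).
    exact: leq_trans (omegaS c r SV) r3.
  exact: leq_trans (omegaS c b SV) b2.
have rY : r \notin Y :\ b by rewrite !inE (negPf (admissible_disj adm rX)) andbF.
have cX : #|X| = #|X :\ r|.+1 by rewrite (cardsD1 r) rX.
have cY : #|Y| = #|Y :\ b|.+1 by rewrite (cardsD1 b) bY.
have cY' : #|r |: (Y :\ b)| = #|Y| by rewrite cardsU1 rY cY.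
have [u_w _] := extremalS_r #|X :\ r| #|Y :\ b|; rewrite -cY in u_w.
have [w_f _] := extremalS_l #|X :\ r| #|Y|; rewrite -cX in w_f.
set u := extremal #|X :\ r| #|Y :\ b| in u_w.
set w := extremal #|X :\ r| #|Y| in u_w w_f.
suff /weight_le/(_ S8) : 2 * #|V| <= w * #|S| by move: w_f; clear; lia.
apply: (card_weighted_parts (p := p)) => // x xV.
have [S1 S2] := S_part x xV; have lt_part := part_proper red xV.
have lr := omega_part_lt c_sym red xV; have lb := omega_part_lt c_sym redC xV.
have admb : admissible c X (Y :\ b) (part p V x).
  by apply: admissible_K3_none (part_admissible x) bY _; lia.
have [r1 | r2] := leqP (omega c r (part p V x)) 1.
  have := IH lt_part (admissible_K4e_none admb rX r1); rewrite -/u => Au.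
  by apply: (weight_le _ S1); move: Au u_w; clear; lia.
have {}S2 : 1 < #|S :&: part p V x| by apply: S2; rewrite r2.
have : admissible c (X :\ r) (r |: (Y :\ b)) (part p V x).
  by apply: admissible_K4e_K3 admb rX _; lia.
by move/(IH lt_part); rewrite cY' -/w => Aw; apply: (weight_le _ S2); rewrite mulnC leq_mul2r Aw orbT.
Qed.

Lemma card_part_nbr r b x : reduced_by c V p r b -> x \in V ->
  #|V| <= #|part p V x| + (#|part_nbr c p V r x| + #|part_nbr c p V b x|).
Proof.
move=> [_ _ two _] xV.
have cover : V \subset part p V x :|: (part_nbr c p V r x :|: part_nbr c p V b x).
  apply/subsetP => y yV; rewrite !inE yV /= [p y == p x]eq_sym.
  have [// | nxy /=] := eqVneq (p x) (p y).
  by have := two x y xV yV nxy; rewrite !inE.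
have := subset_leq_card cover.
have [cU _] := leq_card_setU (part p V x)
  (part_nbr c p V r x :|: part_nbr c p V b x).
have [cU' _] := leq_card_setU (part_nbr c p V r x) (part_nbr c p V b x).
lia.
Qed.

(* A part with red but no blue edges has at most
   [extremal (#|X| - 2) (#|Y| + 1)] vertices, which may be 5/2 times the bound for
   parts without either, although only 2 of its vertices lie in S; the slack is
   recovered from |S| <= 13. *)
Lemma reduced_K4e_K4e r b : reduced_by c V p r b -> ~ decomposable c V ->
  r \in X -> b \in X -> #|V| <= extremal #|X| #|Y|.
Proof.
move=> red indec rX bX; have [nrb _ _ _] := red; have redC := reduced_byC red.
have nbr : b != r by rewrite eq_sym.
have [_ _ _ K4] := adm.
have r3 := omega_K4e_free_reduced c_sym red indec (K4 r rX).
have b3 := omega_K4e_free_reduced c_sym redC indec (K4 b bX).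
have bX' : b \in X :\ r by rewrite !inE nbr.
have rX' : r \in X :\ b by rewrite !inE nrb.
have rY := admissible_disj adm rX; have bY := admissible_disj adm bX.
have cX : #|X| = #|X :\ r :\ b|.+2 by rewrite (cardsD1 r) rX (cardsD1 b) bX'.
have cXr : #|X :\ r| = #|X :\ r :\ b|.+1 by rewrite (cardsD1 b) bX'.
have cXb : #|X :\ b| = #|X :\ r :\ b|.+1.
  by apply/eqP; rewrite -eqSS -cX (cardsD1 b X) bX.
have cYr : #|r |: Y| = #|Y|.+1 by rewrite cardsU1 rY.
have cYb : #|b |: Y| = #|Y|.+1 by rewrite cardsU1 bY.
have cYrb : #|b |: (r |: Y)| = #|Y|.+2.
  by rewrite cardsU1 !inE negb_or nbr bY cYr.
have [_ up_l] := extremalS_l #|X :\ r :\ b| #|Y|.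
have [_ up_r] := extremalS_r #|X :\ r :\ b| #|Y|.
rewrite cX extremalSS_l; set u := extremal #|X :\ r :\ b| #|Y| in up_l up_r *.
have le_part x : x \in V -> omega c r (part p V x) <= 2 /\ omega c b (part p V x) <= 2.
  move=> xV; have := omega_part_lt c_sym red xV.
  by have := omega_part_lt c_sym redC xV; move: r3 b3; clear; lia.
(* A part with both red and blue edges has at most [5 * u] vertices. Its red neighbours span no red
   edge and its blue neighbours no blue one, so each of these sets has at most 17/4 of [u]; the
   total is 13.5 times [u]. *)
have [/exists_inP [x xV /andP [r2 b2]] | no_both] :=
    boolP [exists x in V, (1 < omega c r (part p V x)) && (1 < omega c b (part p V x))].
  have nbr_le i : i \in X -> omega c i V <= 3 -> 1 < omega c i (part p V x) ->
      #|part_nbr c p V i x| <= extremal #|X :\ i| #|Y|.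
    move=> iX i3 i2; apply: (IH (part_nbr_proper c p i xV)).
    apply: (admissible_K4e_none _ iX).
      exact: admissibleS (part_nbr_sub c p V i x) adm.
    by have := omega_part_nbr c_sym red i xV; move: i3 i2; clear; lia.
  have := nbr_le r rX r3 r2; have := nbr_le b bX b3 b2; rewrite cXr cXb.
  have : admissible c (X :\ r :\ b) (b |: (r |: Y)) (part p V x).
    apply: admissible_K4e_K3 bX' _; last by have := le_part x xV; lia.
    by apply: admissible_K4e_K3 rX _; [exact: part_admissible | have := le_part x xV; lia].
  move/(IH (part_proper red xV)); rewrite cYrb extremalSS_r -/u.
  by have := card_part_nbr red xV; move: up_l; clear; lia.
have [S [SV Sb S_part]] := max_bicolored c_sym red.
have no_edge x : x \in V -> omega c r (part p V x) <= 1 ->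
    omega c b (part p V x) <= 1 -> #|part p V x| <= u.
  move=> xV r1 b1; apply: (IH (part_proper red xV)).
  apply: admissible_K4e_none bX' b1; apply: admissible_K4e_none rX r1.
  exact: part_admissible.
have [/exists_inP [x xV edge] | no_edges] := boolP
    [exists x in V, (1 < omega c r (part p V x)) || (1 < omega c b (part p V x))].
  have S13 : #|S| <= 13.
    have S2 := (S_part x xV).2 edge.
    have [r1 | r2] := leqP (omega c r (part p V x)) 1.
      exact: (card_bicolored_edge_in_part c_sym redC b3 r3 SV (bicoloredC Sb) xV r1 S2).
    have b1 : omega c b (part p V x) <= 1.
      rewrite leqNgt; apply: contra no_both => b2.
      by apply/exists_inP; exists x; rewrite ?r2.
    exact: (card_bicolored_edge_in_part c_sym red r3 b3 SV Sb xV b1 S2).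
  (* Per element of [S], a part with edges in one of the colours has at most 5/4 of [u] vertices,
     and the other parts at most [u]; 13 * 5/4 is below 17. *)
  suff /weight_le/(_ S13) : 4 * #|V| <= (5 * u) * #|S| by clear; lia.
  apply: (card_weighted_parts (p := p)) => // {edge}x {}xV.
  have [S1 S2] := S_part x xV; have [r2 b2] := le_part x xV.
  have lt_part := part_proper red xV.
  have [r1 | r_edge] := leqP (omega c r (part p V x)) 1.
    have [b1 | b_edge] := leqP (omega c b (part p V x)) 1.
      have Au := no_edge x xV r1 b1.
      by apply: (weight_le _ S1); move: Au; clear; lia.
    have {}S2 : 1 < #|S :&: part p V x| by apply: S2; rewrite b_edge orbT.
    have : admissible c (X :\ r :\ b) (b |: Y) (part p V x).
      apply: admissible_K4e_K3 bX' b2; apply: admissible_K4e_none rX r1.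
      exact: part_admissible.
    by move/(IH lt_part); rewrite cYb => Aw; apply: (weight_le _ S2); move: Aw up_r; clear; lia.
  have {}S2 : 1 < #|S :&: part p V x| by apply: S2; rewrite r_edge.
  have b1 : omega c b (part p V x) <= 1.
    rewrite leqNgt; apply: contra no_both => b_edge.
    by apply/exists_inP; exists x; rewrite ?r_edge.
  have : admissible c (X :\ r :\ b) (r |: Y) (part p V x).
    rewrite setDDl setUC -setDDl; apply: admissible_K4e_K3 rX' r2.
    apply: admissible_K4e_none bX b1; exact: part_admissible.
  by move/(IH lt_part); rewrite cYr => Aw; apply: (weight_le _ S2); move: Aw up_r; clear; lia.
have S17 : #|S| <= 17.
  apply: (ramsey44 c_sym nrb Sb).
    exact: leq_trans (omegaS c r SV) r3.
  exact: leq_trans (omegaS c b SV) b3.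
suff /weight_le/(_ S17) : 1 * #|V| <= u * #|S| by rewrite mul1n mulnC.
apply: (card_weighted_parts (p := p)) => // x xV.
have [S1 _] := S_part x xV.
have /norP [] : ~~ ((1 < omega c r (part p V x)) || (1 < omega c b (part p V x))).
  by apply: contra no_edges => edge; apply/exists_inP; exists x.
rewrite -!leqNgt => r1 b1; have Au := no_edge x xV r1 b1.
by apply: (weight_le _ S1); rewrite mul1n muln1.
Qed.

End Indecomposable.

Theorem card_le_extremal X Y (V : {set T}) :
  admissible c X Y V -> #|V| <= extremal #|X| #|Y|.
Proof.
suff bound n : bounded_below c n by apply: (bound #|V|.+1).
elim: n => // n IHn {}X {}Y {}V Vn adm.
have IH : bounded_below c #|V|.
  by move=> X' Y' V' V'lt; apply: IHn; apply: leq_trans V'lt _.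
have [V1 | V1] := leqP #|V| 1; first exact: leq_trans V1 (extremal_gt0 _ _).
have [dec | indec] := decomposableP c V.
  exact: (decomposable_bound c_sym IH adm).
have [p [r [b red]]] := gallai_partition_indecomposable c_sym c_tri V1 indec.
have redC := reduced_byC red.
(* Both colours of the reduced graph occur on edges, so neither is an absent colour. *)
have used i j : reduced_by c V p i j -> (i \in X) || (i \in Y).
  move=> redi; have [_ no_i _ _] := adm; have := omega_gt1_reduced c_sym redi V1.
  by apply: contraTT; rewrite negb_or -leqNgt => /andP [? ?]; apply: no_i.
have /orP [rX | rY] := used _ _ red; have /orP [bX | bY] := used _ _ redC.
- exact: (reduced_K4e_K4e IH adm red indec rX bX).
- exact: (reduced_K4e_K3 IH adm red indec rX bY).
- exact: (reduced_K4e_K3 IH adm redC indec bX rY).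
- exact: (reduced_K3_K3 IH adm red rY bY).
Qed.

End UpperBound.

(** * From clique numbers to monochromatic copies *)

(** Copies range over a finite function space, so their existence is decidable and can be proved by
    contradiction. *)
Lemma mono_copyP (k N : nat) (c : 'I_N -> 'I_N -> 'I_k) (H : sgraph) (i : 'I_k) :
  reflect (mono_copy c H i)
    [exists f : {ffun H -> 'I_N}, injectiveb f &&
       [forall u, forall v, adj u v ==> (c (f u) (f v) == i)]].
Proof.
apply: (iffP existsP) => [[f /andP [/injectiveP f_inj h]] | [f [f_inj h]]].
  exists f; split=> // u v uv; apply/eqP.
  by move/forallP/(_ u)/forallP/(_ v): h; rewrite uv.
exists (finfun f); apply/andP; split.
  by apply/injectiveP => u v; rewrite !ffunE; apply: f_inj.
by apply/forallP => u; apply/forallP => v; apply/implyP => uv; rewrite !ffunE h ?eqxx.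
Qed.

Lemma mono_copy_K (k N : nat) (c : 'I_N -> 'I_N -> 'I_k) n i :
  n <= omega c i setT -> mono_copy c (K n) i.
Proof.
case/omega_clique=> X [_ /cliqueP Xi Xn]; pose f (j : 'I_n) := enum_val (cast_ord (esym Xn) j).
have f_inj : injective f by move=> j j' /enum_val_inj/cast_ord_inj.
exists f; split=> // u v uv; apply: Xi; [exact: enum_valP | exact: enum_valP |].
by rewrite (inj_eq f_inj); exact: uv.
Qed.

Lemma mono_copy_K4e (k N : nat) (c : 'I_N -> 'I_N -> 'I_k) i (X : {set 'I_N}) x y :
  (forall x y, c x y = c y x) -> clique c i X -> #|X| = 4 -> x \in X -> y \notin X ->
  c x y = i -> mono_copy c K4e i.
Proof.
move=> c_sym /cliqueP Xi X4 xX nyX cxy.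
(* The vertex [x] comes first because the pendant edge of [K4e] is attached to vertex 0; [y] becomes
   vertex 4. *)
pose s := x :: enum (X :\ x).
have s_size : size s = 4 by rewrite /= -cardE; move: X4; rewrite (cardsD1 x) xX add1n.
have s_uniq : uniq s by rewrite /= enum_uniq mem_enum !inE eqxx.
have sX z : (z \in s) = (z \in X).
  by rewrite inE mem_enum !inE; have [->|] := eqVneq z x.
pose f (j : 'I_5) := nth x (rcons s y) j.
have f_inj : injective f.
  move=> u v /eqP; rewrite nth_uniq ?size_rcons ?s_size // => [/eqP /val_inj //|].
  by rewrite rcons_uniq sX nyX.
have f_s (j : 'I_5) : j < 4 -> f j \in X.
  by move=> j4; rewrite -sX /f nth_rcons s_size j4 mem_nth ?s_size.
have f_x (j : 'I_5) : j = 0 :> nat -> f j = x by rewrite /f => ->.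
have f_y (j : 'I_5) : j = 4 :> nat -> f j = y.
  by rewrite /f => ->; rewrite nth_rcons s_size.
exists f; split=> // u v /andP [nuv /or3P [] /andP []].
- by move=> u4 v4; apply: Xi; rewrite ?f_s // (inj_eq f_inj).
- by move=> /eqP u0 /eqP v4; rewrite f_x ?f_y.
- by move=> /eqP u4 /eqP v0; rewrite c_sym f_x ?f_y.
Qed.

Lemma Gallai_arrows_extremal k s : s <= k ->
  Gallai_arrows (@K4e_K3_family k s) (extremal s (k - s)).+1.
Proof.
move=> sk c [c_sym no_rainbow].
suff /existsP [i /mono_copyP copy] : [exists i, [exists f : {ffun K4e_K3_family s i -> _},
    injectiveb f && [forall u, forall v, adj u v ==> (c (f u) (f v) == i)]]] by exists i.
rewrite -[X in is_true X]negbK; apply/negP => /existsPn no_copy.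
have {}no_copy i : ~ mono_copy c (K4e_K3_family s i) i.
  by move=> copy; have /mono_copyP := copy; apply/negP; apply: no_copy.
pose X := [set i : 'I_k | i < s].
have c_tri x y z : x != y -> y != z -> x != z -> c x y != c x z ->
    c y z = c x y \/ c y z = c x z.
  move=> nxy nyz nxz nc; have [-> | n1] := eqVneq (c y z) (c x y); first by left.
  have [-> | n2] := eqVneq (c y z) (c x z); first by right.
  by case: (no_rainbow x y z); rewrite eq_sym in n1.
have cX : #|X| = s.
  rewrite -sum1dep_card (big_ord_narrow sk) sum_nat_const card_ord muln1 //.
have cY : #|~: X| = k - s by rewrite cardsCs setCK cX card_ord.
have : admissible c X (~: X) setT.
  split.
  - by rewrite disjoints_subset setCK.
  - by move=> i; rewrite !inE => ->.
  - move=> i; rewrite !inE => /negPf is_; rewrite leqNgt; apply/negP => i3.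
    by apply: (no_copy i); rewrite /K4e_K3_family is_; apply: mono_copy_K.
  - move=> i; rewrite inE => is_ Q _ Qi Q4 x y xQ /setDP [_ nyQ] cxy.
    apply: (no_copy i); rewrite /K4e_K3_family is_.
    exact: (mono_copy_K4e c_sym Qi Q4 xQ nyQ cxy).
move/(card_le_extremal c_sym c_tri).
by rewrite cX cY cardsT card_ord ltnn.
Qed.

(** * Lower bound *)

(** Colours are natural numbers and the vertex type is arbitrary, so that a blow-up is a product
    type with fresh colours. *)
Definition Gallai_nat (T : finType) (c : T -> T -> nat) :=
  (forall x y, c x y = c y x) /\
  (forall x y z, x != y -> y != z -> x != z ->
     [\/ c x y = c y z, c y z = c x z | c x y = c x z]).

Definition hom_free (T : finType) (c : T -> T -> nat) (H : sgraph) i :=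
  forall f : H -> T, ~ forall u v, adj u v -> f u != f v /\ c (f u) (f v) = i.

Definition avoidable (H : nat -> sgraph) (n N : nat) :=
  exists (T : finType) (c : T -> T -> nat),
  [/\ #|T| = N, Gallai_nat c, forall x y, x != y -> c x y < n
    & forall i, i < n -> forall f : H i -> T,
        ~ (injective f /\ forall u v, adj u v -> c (f u) (f v) = i)].

(* A blow-up may create non-injective copies, so the outer colouring has to
   exclude homomorphic images of H; the inner one keeps its own copies apart
   because H is connected, for which a dominating vertex is enough here. *)
Lemma avoidable_blow_up (H : nat -> sgraph) n m N (T : finType) (c : T -> T -> nat) :
  (forall i, exists o : H i, forall v, v != o -> adj o v) ->
  Gallai_nat c -> (forall x y, x != y -> n <= c x y < n + m) ->
  (forall i, n <= i < n + m -> hom_free c (H i) i) ->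
  avoidable H n N -> avoidable H (n + m) (#|T| * N).
Proof.
move=> H_dom [c_sym c_tri] c_range c_free [T' [c' [cT' [c'_sym c'_tri] c'_range c'_free]]].
pose d (x y : T * T') := if x.1 == y.1 then c' x.2 y.2 else c x.1 y.1.
exists (T * T')%type, d; split.
- by rewrite card_prod cT'.
- split=> [x y | [x x'] [y y'] [z z']].
    by rewrite /d eq_sym c_sym c'_sym.
  rewrite /d -!pair_eqE /pair_eq /=.
  have [<- | nxy] := eqVneq x y.
    by have [_ | nxz] := eqVneq x z; [apply: c'_tri | constructor 2].
  have [<- | nyz] := eqVneq y z; last first.
    have [-> | nxz] := eqVneq x z; first by constructor 1; rewrite c_sym.
    by move=> _ _ _; apply: c_tri.
  by rewrite (negPf nxy); constructor 3.
- move=> [x x'] [y y']; rewrite /d -pair_eqE /pair_eq /=.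
  have [_ /= nxy' | nxy _] := eqVneq x y; last by have /andP [] := c_range x y nxy.
  by apply: leq_trans (c'_range _ _ nxy') (leq_addr _ _).
move=> i i_lt f [f_inj f_col].
(* Off the diagonal, colours from [n] on occur only between different fibres, so projecting a copy
   gives a homomorphic image in the outer colouring; smaller colours keep a copy inside one
   fibre. *)
have [i_n | n_i] := ltnP i n; last first.
  apply: (c_free i _ (fst \o f)); first by rewrite n_i.
  move=> u v uv /=; have := f_col u v uv; rewrite /d.
  have [e1 | //] := eqVneq (f u).1 (f v).1.
  have n2 : (f u).2 != (f v).2.
    apply: contraTneq uv => e2; have -> : u = v.
      by apply: f_inj; rewrite (surjective_pairing (f u)) e1 e2 -surjective_pairing.
    by rewrite adj_irr.
  by move=> ci; have := c'_range _ _ n2; rewrite ci ltnNge n_i.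
have same u v : adj u v -> (f u).1 = (f v).1.
  move=> uv; have := f_col u v uv; rewrite /d.
  have [// | nuv ci] := eqVneq (f u).1 (f v).1.
  by have := c_range _ _ nuv; rewrite ci leqNgt i_n.
have [o o_dom] := H_dom i.
have f1 u : (f u).1 = (f o).1.
  by have [-> // | nuo] := eqVneq u o; rewrite -(same o u) ?o_dom.
apply: (c'_free i i_n (snd \o f)); split=> [u v /= e2 | u v uv /=].
  by apply: f_inj; rewrite (surjective_pairing (f u)) f1 e2 -(f1 v) -surjective_pairing.
by have := f_col u v uv; rewrite /d !f1 eqxx.
Qed.

(** * Circulant two-colourings *)

Definition circulant (q : nat) (R : seq nat) (x y : nat) : bool :=
  (x + q - y) %% q \notin R.

Definition circulant_sym (q : nat) (R : seq nat) : bool :=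
  all (fun x => all (fun y => circulant q R x y == circulant q R y x) (iota 0 q)) (iota 0 q).

(* The nested conditionals make the search short-circuit during evaluation. *)
Definition circulant_K3_free (q : nat) (R : seq nat) (e : bool) : bool :=
  let edge x y := if x == y then false else circulant q R x y == e in
  all (fun x => all (fun y => if edge x y then
    all (fun z => if edge x z then ~~ edge y z else true) (iota 0 q)
    else true) (iota 0 q)) (iota 0 q).

Definition circulant_K4_free (q : nat) (R : seq nat) (e : bool) : bool :=
  let edge x y := if x == y then false else circulant q R x y == e in
  all (fun x => all (fun y => if edge x y then
    all (fun z => if edge x z then if edge y z then
      all (fun t => if edge x t then if edge y t then ~~ edge z t else true
         else true) (iota 0 q) else true else true) (iota 0 q)
    else true) (iota 0 q)) (iota 0 q).

Lemma all_iotaP (q : nat) (P : pred nat) (x : 'I_q) : all P (iota 0 q) -> P x.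
Proof. by move/allP; apply; rewrite mem_iota add0n /=. Qed.

(** [circulant] is true off [R], so differences in [R] get colour [n] and all others [n + 1]; adding
    [q] first keeps the subtraction from truncating. *)
Definition circulant_coloring n q R (x y : 'I_q) : nat := n + circulant q R x y.

Lemma circulant_Gallai n q R : circulant_sym q R ->
  Gallai_nat (@circulant_coloring n q R).
Proof.
move=> sym; rewrite /circulant_coloring; split=> [x y | x y z _ _ _].
  by move/(@all_iotaP _ _ x)/(@all_iotaP _ _ y)/eqP: sym => ->.
do 3!case: (circulant q R _ _); by [constructor 1 | constructor 2 | constructor 3].
Qed.

Lemma circulant_range n q R (x y : 'I_q) : n <= circulant_coloring n R x y < n + 2.
Proof. by rewrite /circulant_coloring; case: circulant; lia. Qed.

Lemma circulant_hom_edge n q R (x y : 'I_q) i : n <= i ->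
  x != y /\ circulant_coloring n R x y = i ->
  (if x == y :> nat then false else circulant q R x y == (n < i)).
Proof.
move=> ni [nxy <-]; rewrite -[_ == _ :> nat]/(x == y) (negPf nxy).
by rewrite /circulant_coloring; case: circulant; lia.
Qed.

Lemma circulant_K3_hom_free n q R i :
  (forall e, circulant_K3_free q R e) -> n <= i -> hom_free (@circulant_coloring n q R) (K 3) i.
Proof.
move=> free ni f hom.
have edge u v uv := circulant_hom_edge ni (hom u v uv).
have := free (n < i).
move/(@all_iotaP _ _ (f (inord 0)))/(@all_iotaP _ _ (f (inord 1))).
have n01 : adj (inord 0 : K 3) (inord 1) by rewrite /= /K_adj -val_eqE /= !inordK.
have n02 : adj (inord 0 : K 3) (inord 2) by rewrite /= /K_adj -val_eqE /= !inordK.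
have n12 : adj (inord 1 : K 3) (inord 2) by rewrite /= /K_adj -val_eqE /= !inordK.
rewrite (edge _ _ n01) => /(@all_iotaP _ _ (f (inord 2))).
by rewrite (edge _ _ n02) (edge _ _ n12).
Qed.

(** The K_4 inside K_4 + e suffices: a homomorphism separates adjacent vertices, so its image is
    again a K_4. *)
Lemma circulant_K4e_hom_free n q R i :
  (forall e, circulant_K4_free q R e) -> n <= i -> hom_free (@circulant_coloring n q R) K4e i.
Proof.
move=> free ni f hom.
have edge a b : a < 4 -> b < 4 -> a != b ->
    (if f (inord a) == f (inord b) :> nat then false
     else circulant q R (f (inord a)) (f (inord b)) == (n < i)).
  move=> a4 b4 nab; apply: circulant_hom_edge ni _; apply: hom.
  by rewrite /= /K4e_adj -val_eqE /= !inordK ?a4 ?b4 ?nab // ltnW.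
have := free (n < i).
move/(@all_iotaP _ _ (f (inord 0)))/(@all_iotaP _ _ (f (inord 1))).
rewrite (edge 0 1) // => /(@all_iotaP _ _ (f (inord 2))).
rewrite (edge 0 2) // (edge 1 2) // => /(@all_iotaP _ _ (f (inord 3))).
by rewrite (edge 0 3) // (edge 1 3) // (edge 2 3).
Qed.

(** The nonzero squares modulo 17. *)
Definition Paley17 := [:: 1; 2; 4; 8; 9; 13; 15; 16].

Lemma Paley17_sym : circulant_sym 17 Paley17.
Proof. by vm_compute. Qed.

Lemma Paley17_K4_free e : circulant_K4_free 17 Paley17 e.
Proof. by case: e; vm_compute. Qed.

Lemma pentagon_sym : circulant_sym 5 [:: 1; 4].
Proof. by vm_compute. Qed.

Lemma pentagon_K3_free e : circulant_K3_free 5 [:: 1; 4] e.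
Proof. by case: e; vm_compute. Qed.

(** * The extremal colourings *)

Section LowerBound.
Context (s : nat).

Let H i := if i < s then K4e else K 3.

Lemma family_dominating i : exists o : H i, forall v, v != o -> adj o v.
Proof.
rewrite /H; case: (i < s).
  exists (ord0 : 'I_5) => /= v; rewrite /K4e_adj eq_sym => -> /=.
  by case: v => -[|[|[|[|[|]]]]].
by exists (ord0 : 'I_3) => /= v; rewrite /K_adj eq_sym.
Qed.

Lemma avoidable_K4e a : a <= s -> avoidable H a (K4e_factor a).
Proof.
elim/nat_ind2: a => [_ | s1 | a IHa a_s].
- by exists unit, (fun _ _ => 0); split=> //; rewrite card_unit.
(* Four vertices are too few for K_4 + e. This layer has to be the innermost one, since K_4 + e maps
   homomorphically to K_4. *)
- exists 'I_4, (fun _ _ => 0); split=> //; first by rewrite card_ord.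
    by split=> // *; constructor 1.
  move=> [|//] _; rewrite /H s1 => f [f_inj _].
  by have := leq_card f f_inj; rewrite !card_ord.
rewrite -[K4e_factor _]/(17 * K4e_factor a) -[a.+2]addn2 -[X in X * _](card_ord 17).
apply: (avoidable_blow_up (c := @circulant_coloring a 17 Paley17)) => //.
- exact: family_dominating.
- exact: circulant_Gallai Paley17_sym.
- by move=> x y _; apply: circulant_range.
- move=> i /andP [ai i_lt]; have is_ : i < s by lia.
  by rewrite /H is_; apply: circulant_K4e_hom_free => //; apply: Paley17_K4_free.
- by apply: IHa; lia.
Qed.

Lemma avoidable_family b : avoidable H (s + b) (extremal s b).
Proof.
elim/nat_ind2: b => [|| b IHb].
- by rewrite addn0 /extremal muln1; apply: avoidable_K4e.
(* An unpaired K_3 colour is spent on a K_2; a homomorphic image of K_3 would need three distinct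
   vertices. *)
- rewrite /extremal mulnC -[K3_factor 1]/2 -[X in X * _](card_ord 2).
  apply: (avoidable_blow_up (c := fun _ _ : 'I_2 => s)).
  + exact: family_dominating.
  + by split=> // *; constructor 1.
  + by move=> *; lia.
  + move=> i /andP [si _] f; rewrite /H ltnNge si /= in f * => hom.
    have f_inj : injective f.
      move=> u v; apply: contra_eq => nuv.
      by have [] := hom u v nuv.
    by have := leq_card f f_inj; rewrite !card_ord.
  + exact: avoidable_K4e.
rewrite extremalSS_r -addn2 addnA -[X in X * _](card_ord 5).
apply: (avoidable_blow_up (c := @circulant_coloring (s + b) 5 [:: 1; 4])) => //.
- exact: family_dominating.
- exact: circulant_Gallai pentagon_sym.
- by move=> x y _; apply: circulant_range.
- move=> i /andP [sbi _]; have /negPf is_ : ~~ (i < s) by lia.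
  by rewrite /H is_; apply: circulant_K3_hom_free => //; apply: pentagon_K3_free.
Qed.

End LowerBound.

Lemma not_Gallai_arrows_extremal k s M : 1 <= k -> s <= k ->
  M <= extremal s (k - s) -> ~ Gallai_arrows (@K4e_K3_family k s) M.
Proof.
case: k => // k _ sk M_le arrows.
have [T [c [cT [c_sym c_tri] c_range c_free]]] := avoidable_family s (k.+1 - s).
rewrite subnKC // in c_range c_free.
have MT : M <= #|T| by rewrite cT.
pose e (x : 'I_M) : T := enum_val (widen_ord MT x).
have e_inj : injective e by move=> x y /enum_val_inj/(congr1 val)/= /val_inj.
(* Off the diagonal [c] stays below the number of colours, so there [inord] keeps the value; on the
   diagonal it may be junk. *)
pose d x y : 'I_k.+1 := inord (c (e x) (e y)).
have dE x y : x != y -> d x y = c (e x) (e y) :> nat.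
  by move=> nxy; rewrite inordK // c_range // (inj_eq e_inj).
have d_Gallai : Gallai_coloring d.
  split=> [x y | x y z [[nxy nyz nxz] []]]; first by rewrite /d c_sym.
  rewrite -!val_eqE /= !dE // => n1 n2 n3.
  case: (c_tri (e x) (e y) (e z)); rewrite ?(inj_eq e_inj) // => eq_c.
  - by rewrite eq_c eqxx in n1.
  - by rewrite eq_c eqxx in n2.
  - by rewrite eq_c eqxx in n3.
have [i [f [f_inj f_col]]] := arrows d d_Gallai.
apply: (c_free i (ltn_ord i) (e \o f)); split; first exact: inj_comp.
move=> u v uv /=; rewrite -dE ?f_col //.
by rewrite (inj_eq f_inj); apply: contraTneq uv => ->; rewrite adj_irr.
Qed.

Theorem theorem5p1 (k s : nat) (hk : 1 <= k) (hs : s <= k) :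
  is_GR (@K4e_K3_family k s)
    (if ~~ odd s && ~~ odd (k - s) then
       17 ^ (s %/ 2) * 5 ^ ((k - s) %/ 2) + 1
     else if ~~ odd s && odd (k - s) then
       2 * 17 ^ (s %/ 2) * 5 ^ ((k - s - 1) %/ 2) + 1
     else if odd s && odd (k - s) then
       8 * 17 ^ ((s - 1) %/ 2) * 5 ^ ((k - s - 1) %/ 2) + 1
     else
       4 * 17 ^ ((s - 1) %/ 2) * 5 ^ ((k - s) %/ 2) + 1).
Proof.
have half_odd n : odd n -> (n - 1) %/ 2 = n %/ 2.
  by rewrite !divn2; case: n => // n /= /negPf; rewrite subn1 /= uphalf_half => ->.
set N := (X in is_GR _ X); have -> : N = (extremal s (k - s)).+1.
  rewrite /N addn1 /extremal K4e_factorE K3_factorE.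
  (* The constant 8 is the product of the factors 4 and 2 of two unpaired colours. *)
  case: (boolP (odd s)) => os; case: (boolP (odd (k - s))) => ok /=; rewrite ?half_odd //; lia.
split=> [|M arrows]; first exact: Gallai_arrows_extremal.
rewrite ltnNge; apply/negP => M_le.
exact: not_Gallai_arrows_extremal hk hs M_le arrows.
Qed.
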